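(* Let $n$ be a positive integer. For each $k$ from $1$ to $n$ let $B_k$ be a subset of $K_n-\{\vec 0\}$ containing an even number of $k$-odd vectors. Then there exists an $n$-component Gauss phrase $p$ such that $B_k(p)=B_k$ for all $k$ from $1$ to $n$.
   Context: A word on an alphabet (finite set) $\mathcal{A}$ is a finite, possibly empty, sequence of letters of $\mathcal{A}$. A Gauss word on $\mathcal{A}$ is a word on $\mathcal{A}$ in which every letter of $\mathcal{A}$ appears exactly twice. A Gauss phrase on $\mathcal{A}$ is a finite sequence of words $x_1,\dots,x_m$ on $\mathcal{A}$ whose concatenation $x_1x_2\cdots x_m$ is a Gauss word on $\mathcal{A}$; the $x_i$ are its components. Write $K_n=(\mathbb{Z}/2\mathbb{Z})^n$. A vector in $K_n$ is $k$-odd if its $k$th entry is $1$. Let $p$ be an $n$-component Gauss phrase. For a (contiguous) subword $w$ of a component of $p$, the linking vector $\overrightarrow{l(w)}\in K_n$ is the vector whose $i$th entry is the number, modulo $2$, of letters which occur exactly once in $w$ and whose other occurrence is in the $i$th component of $p$. A single-component letter is a letter both of whose occurrences are in the same component. If $A$ is a single-component letter in the $k$th component, that component has the form $xAyAz$ with $x,y,z$ possibly empty words, and the linking vector of $A$ is $\overrightarrow{l(A)}=\overrightarrow{l(y)}$. Let $\mathcal{A}_k$ be the set of single-component letters appearing in the $k$th component of $p$, and for $\vec v\in K_n$ let $d_k(\vec v)=\#\{X\in\mathcal{A}_k : \overrightarrow{l(X)}=\vec v\}$. Define $$B_k(p)=\{\vec v\in K_n-\{\vec 0\} : d_k(\vec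 v)\text{ is odd}\}.$$ *)

(* Defs.v *)
From mathcomp Require Import all_boot all_order all_algebra.

Set Implicit Arguments.
Unset Strict Implicit.
Unset Printing Implicit Defensive.

Import GRing.Theory.
Local Open Scope ring_scope.

Notation K n := 'rV['F_2]_n.

Definition k_odd (n : nat) (k : 'I_n) (v : K n) : bool := v 0 k == 1.

Definition gauss_word (A : finType) (w : seq A) : Prop :=
  forall X : A, count_mem X w = 2%N.

Definition gauss_phrase (A : finType) (n : nat) (p : n.-tuple (seq A)) : Prop :=
  gauss_word (flatten p).

Section LinkingVectors.

Variables (A : finType) (n : nat) (p : n.-tuple (seq A)).

(* For a letter X occurring in component k of a Gauss phrase: its other
   occurrence is in component i. *)
Definition other_in (k : 'I_n) (X : A) (i : 'I_n) : bool :=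
  if i == k then count_mem X (tnth p k) == 2%N else X \in tnth p i.

(* w is meant to be a contiguous subword of component k. *)
Definition linking_vector (k : 'I_n) (w : seq A) : K n :=
  \row_i #|[set X : A | (count_mem X w == 1%N) && other_in k X i]|%:R.

Definition single_component_letters (k : 'I_n) : {set A} :=
  [set X : A | count_mem X (tnth p k) == 2%N].

(* The subword y of s = x X y X z; see betweenE. *)
Definition between (X : A) (s : seq A) : seq A :=
  let t := drop (index X s).+1 s in take (index X t) t.

Definition letter_linking_vector (k : 'I_n) (X : A) : K n :=
  linking_vector k (between X (tnth p k)).

Definition d (k : 'I_n) (v : K n) : nat :=
  #|[set X in single_component_letters k | letter_linking_vector k X == v]|.

Definition Bset (k : 'I_n) : {set K n} :=
  [set v : K n | (v != 0) && odd (d k v)].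

End LinkingVectors.

Fact betweenE (A : finType) (X : A) (x y z : seq A) :
  X \notin x -> X \notin y -> between X (x ++ X :: y ++ X :: z) = y.
Proof.
move=> /negPf Xx /negPf Xy.
rewrite /between index_cat Xx /= eqxx addn0 -cat_rcons drop_size_cat ?size_rcons //.
by rewrite index_cat Xy /= eqxx addn0 take_size_cat.
Qed.

(* Main.v *)
Require Import Defs.
From mathcomp Require Import all_boot all_order all_algebra.

Set Implicit Arguments.
Unset Strict Implicit.
Unset Printing Implicit Defensive.

Import GRing.Theory.
Local Open Scope ring_scope.

(** Concatenating two phrases over disjoint alphabets component by component
    preserves all linking vectors, so the families realized by Gauss phrases are
    closed under symmetric difference.  If u is not k-odd, the phrase whose kth
    component is A X_i1 ... X_ir A, where the X_i with u_i = 1 recur alone in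
    component i, realizes {u} in component k and nothing elsewhere.  If u is
    k-odd, A X_i1 ... X_ir X_k A X_k realizes the symmetric difference of {u} and
    {e_k}.  Summing over u in B k and over k, the e_k cancel by parity. *)

(** * Occurrences of letters in words and phrases *)

Lemma mem_split_first (T : eqType) (X : T) (s : seq T) :
  X \in s -> exists x z, s = x ++ X :: z /\ X \notin x.
Proof.
elim: s => // a s IHs; rewrite inE.
have [-> _|neq /= /IHs [x [z [-> Xx]]]] := eqVneq X a; first by exists [::], s.
by exists (a :: x), z; rewrite inE negb_or neq.
Qed.

Lemma count2_split (T : eqType) (X : T) (s : seq T) :
  count_mem X s = 2%N ->
  exists x y z, [/\ s = x ++ X :: y ++ X :: z, X \notin x & X \notin y].
Proof.
move=> c2; have /mem_split_first[x [t [def_s Xx]]] : X \in s.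
  by rewrite -has_pred1 has_count c2.
have /mem_split_first[y [z [def_t Xy]]] : X \in t.
  rewrite -has_pred1 has_count; move: c2.
  by rewrite def_s count_cat (count_memPn Xx) /= eqxx add0n add1n => -[->].
by exists x, y, z; rewrite -def_t.
Qed.

Lemma gauss_phraseE (A : finType) (n : nat) (p : n.-tuple (seq A)) :
  gauss_phrase p <-> forall X, (\sum_i count_mem X (tnth p i) = 2)%N.
Proof.
have count_sum X : count_mem X (flatten p) = (\sum_i count_mem X (tnth p i))%N.
  by rewrite count_flatten sumnE big_map big_tuple.
by split=> gp X; move: (gp X); rewrite count_sum.
Qed.

(** * Phrases embedded blockwise in larger phrases *)

Section Embedding.

Variables (A C : finType) (n : nat) (f : A -> C).
Variables (p : n.-tuple (seq A)) (q : n.-tuple (seq C)).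
Hypothesis f_inj : injective f.
Hypothesis embed : forall i, exists l r,
  [/\ tnth q i = l ++ map f (tnth p i) ++ r,
      forall X, f X \notin l & forall X, f X \notin r].

Lemma count_mem_map_inj (X : A) (s : seq A) :
  count_mem (f X) (map f s) = count_mem X s.
Proof. by rewrite count_map; apply: eq_count => Y /=; rewrite inj_eq. Qed.

Lemma count_mem_embed (X : A) (i : 'I_n) :
  count_mem (f X) (tnth q i) = count_mem X (tnth p i).
Proof.
have [l [r [-> l'X r'X]]] := embed i.
rewrite !count_cat count_mem_map_inj.
by rewrite (count_memPn (l'X X)) (count_memPn (r'X X)) addn0.
Qed.

Lemma other_in_embed (k : 'I_n) (X : A) (i : 'I_n) :
  other_in q k (f X) i = other_in p k X i.
Proof. by rewrite /other_in -!has_pred1 !has_count !count_mem_embed. Qed.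

(** Only letters occurring in the word count, and those of [map f w] all lie in the image of [f]; so
    the foreign letters of [q] contribute nothing. *)
Lemma linking_vector_embed (k : 'I_n) (w : seq A) :
  linking_vector q k (map f w) = linking_vector p k w.
Proof.
apply/rowP=> i; rewrite !mxE; congr (_%:R).
rewrite -[RHS](card_imset _ f_inj); apply: eq_card => Y; rewrite inE.
apply/idP/imsetP=> [/andP[cY oY]|[X]].
  have /mapP[X _ def_Y] : Y \in map f w by rewrite -has_pred1 has_count (eqP cY).
  exists X => //; rewrite inE.
  by move: cY oY; rewrite def_Y count_mem_map_inj other_in_embed => -> ->.
by rewrite inE => cX ->; rewrite count_mem_map_inj other_in_embed.
Qed.

(** Both occurrences of [f X] lie in the embedded block, so the word between them does too. For a
    letter occurring once, [between] would run to the end of the component and take in [r]. *)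
Lemma letter_linking_vector_embed (k : 'I_n) (X : A) :
    count_mem X (tnth p k) = 2%N ->
  letter_linking_vector q k (f X) = letter_linking_vector p k X.
Proof.
move=> /count2_split[x [y [z [def_p Xx Xy]]]].
have [l [r [def_q l'X r'X]]] := embed k.
rewrite /letter_linking_vector -linking_vector_embed def_q def_p betweenE //.
congr (linking_vector q k _); rewrite map_cat /= map_cat /=.
rewrite -!catA /= -!catA /= catA betweenE ?mem_cat ?mem_map //.
by rewrite negb_or l'X.
Qed.

(** Counting over the preimage leaves out the letters of [q] outside the image of [f]; for a
    disjoint union of alphabets, two such counts add up to [d q k v]. *)
Lemma d_embed (k : 'I_n) (v : K n) :
  #|[set X | f X \in [set Y in single_component_letters q k |
                       letter_linking_vector q k Y == v]]| = d p k v.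
Proof.
apply: eq_card => X; rewrite !inE count_mem_embed.
by case: eqP => //= /letter_linking_vector_embed->.
Qed.

End Embedding.

(** * Componentwise concatenation over disjoint alphabets *)

Definition phrase_cat (A1 A2 : finType) (n : nat) (p1 : n.-tuple (seq A1))
    (p2 : n.-tuple (seq A2)) : n.-tuple (seq (A1 + A2)) :=
  [tuple map inl (tnth p1 i) ++ map inr (tnth p2 i) | i < n].

Section PhraseCat.

Variables (A1 A2 : finType) (n : nat).
Variables (p1 : n.-tuple (seq A1)) (p2 : n.-tuple (seq A2)).
Let q := phrase_cat p1 p2.

Lemma phrase_cat_inl (i : 'I_n) : exists l r,
  [/\ tnth q i = l ++ map inl (tnth p1 i) ++ r,
      forall X : A1, inl X \notin l & forall X : A1, inl X \notin r].
Proof.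
exists [::], (map inr (tnth p2 i)); rewrite tnth_mktuple.
by split=> // X; apply/mapP=> -[].
Qed.

Lemma phrase_cat_inr (i : 'I_n) : exists l r,
  [/\ tnth q i = l ++ map inr (tnth p2 i) ++ r,
      forall X : A2, inr X \notin l & forall X : A2, inr X \notin r].
Proof.
exists (map inl (tnth p1 i)), [::]; rewrite tnth_mktuple cats0.
by split=> // X; apply/mapP=> -[].
Qed.

Lemma gauss_phrase_cat : gauss_phrase p1 -> gauss_phrase p2 -> gauss_phrase q.
Proof.
move=> /gauss_phraseE g1 /gauss_phraseE g2; apply/gauss_phraseE=> -[X|X].
  rewrite -[RHS](g1 X); apply: eq_bigr => i _.
  exact: (count_mem_embed inl_inj phrase_cat_inl).
rewrite -[RHS](g2 X); apply: eq_bigr => i _.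
exact: (count_mem_embed inr_inj phrase_cat_inr).
Qed.

Lemma d_phrase_cat (k : 'I_n) (v : K n) : d q k v = (d p1 k v + d p2 k v)%N.
Proof.
rewrite -(d_embed inl_inj phrase_cat_inl) -(d_embed inr_inj phrase_cat_inr).
rewrite /d -!sum1dep_card big_sumType /=.
by congr (_ + _)%N; apply: eq_bigl => X; rewrite !inE.
Qed.

End PhraseCat.

(** * Families realized by Gauss phrases *)

(** Families are boolean functions, so that symmetric difference is [addb]. Leaving the zero vector
    unconstrained allows filler letters of linking vector 0. *)
Definition realizable (n : nat) (F : 'I_n -> K n -> bool) : Prop :=
  exists (A : finType) (p : n.-tuple (seq A)),
    gauss_phrase p /\ forall k v, v != 0 -> odd (d p k v) = F k v.

Lemma realizable_false (n : nat) : realizable (fun (_ : 'I_n) _ => false).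
Proof.
exists void, [tuple [::] | _ < n]; split=> [[]|k v _].
by rewrite /d eq_card0 // => -[].
Qed.

Lemma realizable_addb (n : nat) (F G : 'I_n -> K n -> bool) :
  realizable F -> realizable G -> realizable (fun k v => F k v (+) G k v).
Proof.
move=> [A1 [p1 [g1 F1]]] [A2 [p2 [g2 F2]]].
exists (A1 + A2)%type, (phrase_cat p1 p2).
by split=> [|k v v0]; [exact: gauss_phrase_cat | rewrite d_phrase_cat oddD F1 ?F2].
Qed.

Lemma realizable_big (n : nat) (I : Type) (r : seq I) (P : pred I)
    (F : I -> 'I_n -> K n -> bool) :
    (forall x, realizable (F x)) ->
  realizable (fun k v => \big[addb/false]_(x <- r | P x) F x k v).
Proof.
move=> rF; elim: r => [|x r [A [p [gp IH]]]].
  (* The families agree only pointwise, so the witness is reused instead of rewriting the family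
     under [realizable]. *)
  have [A [p [gp IH]]] := realizable_false n.
  by exists A, p; split=> // k v v0; rewrite big_nil IH.
have [Px|P'x] := boolP (P x); last first.
  by exists A, p; split=> // k v v0; rewrite big_cons (negPf P'x) IH.
have rIH : realizable (fun k v => \big[addb/false]_(x <- r | P x) F x k v).
  by exists A, p.
have [C [q [gq IHq]]] := realizable_addb (rF x) rIH.
by exists C, q; split=> // k v v0; rewrite big_cons Px IHq.
Qed.

(** * The phrase attached to one vector and one component *)

Section Generator.

Variables (n : nat) (k : 'I_n) (u : K n).

(* The letter None is A, and Some i is X_i; letters X_i with u_i = 0 occur as
   X_i X_i in component i, hence have linking vector 0.  X_k comes last in the
   core so that it is linked with A only. *)
Definition gen_core : seq (option 'I_n) :=
  [seq Some j | j <- enum 'I_n & (u 0 j == 1) && (j != k)]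
    ++ nseq (u 0 k == 1) (Some k).

Definition gen_component (i : 'I_n) : seq (option 'I_n) :=
  (if i == k then None :: gen_core ++ [:: None] else [::])
    ++ nseq (2 - (u 0 i == 1)%R) (Some i).

Definition gen_phrase : n.-tuple (seq (option 'I_n)) :=
  [tuple gen_component i | i < n].

Lemma count_gen_core_None : count_mem None gen_core = 0%N.
Proof.
apply/count_memPn; rewrite mem_cat mem_nseq andbF orbF.
by apply/mapP=> -[].
Qed.

Lemma count_gen_core_Some (j : 'I_n) :
  count_mem (Some j) gen_core = (u 0 j == 1).
Proof.
rewrite count_cat count_map count_nseq /= (inj_eq Some_inj).
rewrite (@eq_count _ _ (pred1 j)) => [|i /=]; last by rewrite (inj_eq Some_inj).
rewrite count_uniq_mem; last exact/filter_uniq/enum_uniq.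
rewrite mem_filter mem_enum andbT.
rewrite [k == j]eq_sym.
by have [->|_] := eqVneq j k; rewrite ?andbF ?andbT ?mul1n ?addn0.
Qed.

Lemma count_gen_None (i : 'I_n) :
  count_mem None (tnth gen_phrase i) = ((i == k) * 2)%N.
Proof.
rewrite tnth_mktuple /gen_component count_cat count_nseq addn0.
by case: eqP => //= _; rewrite count_cat count_gen_core_None.
Qed.

Lemma count_gen_Some (i j : 'I_n) :
  count_mem (Some j) (tnth gen_phrase i) =
    ((i == k) * (u 0 j == 1)%R + (i == j) * (2 - (u 0 j == 1)%R))%N.
Proof.
rewrite tnth_mktuple /gen_component count_cat count_nseq /=.
rewrite (inj_eq Some_inj); congr (_ + _)%N; last by case: eqP => // ->.
by case: eqP => //= _; rewrite count_cat count_gen_core_Some /= !addn0 mul1n.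
Qed.

Lemma gauss_phrase_gen : gauss_phrase gen_phrase.
Proof.
have sum_eq (i : 'I_n) (a : nat) : (\sum_j (j == i) * a = a)%N.
  by rewrite (bigD1 i) //= eqxx mul1n big1 ?addn0 // => j /negPf->.
apply/gauss_phraseE=> -[j|].
  rewrite (eq_bigr _ (fun i _ => count_gen_Some i j)) big_split /= !sum_eq.
  by case: (_ == 1).
by rewrite (eq_bigr _ (fun i _ => count_gen_None i)) sum_eq.
Qed.

Lemma other_in_gen_None (i : 'I_n) : other_in gen_phrase k None i = (i == k).
Proof.
rewrite /other_in; case: eqP => [_|/eqP/negPf ik]; first by rewrite count_gen_None eqxx.
by rewrite -has_pred1 has_count count_gen_None ik.
Qed.

Lemma other_in_gen_Some (i j : 'I_n) :
  other_in gen_phrase k (Some j) i = (i == j).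
Proof.
rewrite /other_in; case: eqP => [->|/eqP/negPf ik].
  by rewrite count_gen_Some eqxx; case: (k == j); case: (u 0 j == 1).
rewrite -has_pred1 has_count count_gen_Some ik.
by case: (i == j); case: (u 0 j == 1).
Qed.

Lemma F2_eq1 (a : 'F_2) : (a == 1)%:R = a.
Proof. by case: a => -[|[|]] // lt_a; apply: val_inj. Qed.

(** Entry [i] can only come from [Some i]: it occurs in the core, once, exactly when [u 0 i = 1],
    and its other occurrence is then at the end of component [i], also for [i = k]. *)
Lemma linking_gen_core : linking_vector gen_phrase k gen_core = u.
Proof.
apply/rowP=> i; rewrite mxE -[RHS]F2_eq1; congr (_%:R).
rewrite (cardsD1 (Some i)) inE count_gen_core_Some other_in_gen_Some eqxx andbT eqb1.
rewrite (@eq_card0 _ (_ :\ _)) ?addn0 // => -[j|]; rewrite !inE.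
  by rewrite other_in_gen_Some (inj_eq Some_inj) [i == j]eq_sym; case: eqP; rewrite ?andbF.
by rewrite count_gen_core_None.
Qed.

Lemma linking_gen_seq1 :
  linking_vector gen_phrase k [:: None] = delta_mx 0 k.
Proof.
apply/rowP=> i; rewrite !mxE /=; congr (_%:R).
rewrite (cardsD1 None) inE /= other_in_gen_None.
by rewrite (@eq_card0 _ (_ :\ _)) ?addn0 // => -[j|]; rewrite !inE.
Qed.

Lemma linking_vector_nil (A : finType) (p : n.-tuple (seq A)) (i : 'I_n) :
  linking_vector p i [::] = 0.
Proof.
apply/rowP=> j; rewrite !mxE eq_card0 // => X.
by rewrite !inE.
Qed.

Lemma letter_linking_gen_None :
  letter_linking_vector gen_phrase k None = u.
Proof.
rewrite /letter_linking_vector tnth_mktuple /gen_component eqxx /= -catA /=.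
rewrite (@betweenE _ None [::]) ?linking_gen_core //.
by rewrite -has_pred1 has_count count_gen_core_None.
Qed.

(** Component [k] ends in X_k A X_k, so only A stands between the two X_k. *)
Lemma letter_linking_gen_odd : u 0 k = 1 ->
  letter_linking_vector gen_phrase k (Some k) = delta_mx 0 k.
Proof.
move=> uk; rewrite /letter_linking_vector tnth_mktuple /gen_component eqxx.
rewrite /gen_core uk eqxx /= -!catA -linking_gen_seq1.
congr (linking_vector _ _ _).
apply: (@betweenE _ _ (None :: _) [:: None] [::]) => //; rewrite inE /=.
by apply/mapP=> -[j]; rewrite mem_filter => /andP[/andP[_ jk] _] [/eqP]; rewrite eq_sym (negPf jk).
Qed.

Lemma letter_linking_gen_even (i : 'I_n) : u 0 i != 1 ->
  letter_linking_vector gen_phrase i (Some i) = 0.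
Proof.
move=> ui; rewrite /letter_linking_vector tnth_mktuple /gen_component (negPf ui) /=.
rewrite (@betweenE _ _ _ [::] [::]) ?linking_vector_nil //.
case: eqP => // _; rewrite inE mem_cat inE /= orbF.
by rewrite -has_pred1 has_count count_gen_core_Some (negPf ui).
Qed.

Lemma odd_d_gen (i : 'I_n) (v : K n) : v != 0 ->
  odd (d gen_phrase i v) =
    (i == k) && ((u == v) (+) (k_odd k u && (delta_mx 0 k == v))).
Proof.
(* Only [None] and [Some i] can occur twice in component [i], so these two are split off and the
   remaining set is empty. *)
move=> v0; rewrite /d /k_odd (cardsD1 None) (cardsD1 (Some i)) !inE.
rewrite (@eq_card0 _ (_ :\ _)) ?addn0 => [|[j|]]; last by rewrite !inE.
  rewrite count_gen_None count_gen_Some eqxx mul1n oddD !oddb.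
  have [->|_] /= := eqVneq i k.
    rewrite letter_linking_gen_None; congr (_ (+) _).
    have [uk|uk] := eqVneq (u 0 k) 1; first by rewrite letter_linking_gen_odd.
    by rewrite letter_linking_gen_even // [0 == v]eq_sym (negPf v0).
  have [//|ui] := eqVneq (u 0 i) 1.
  by rewrite letter_linking_gen_even // [0 == v]eq_sym (negPf v0).
rewrite !inE count_gen_Some (inj_eq Some_inj) [j == i]eq_sym.
by case: eqP => //= _; case: (_ == k); case: (_ == 1).
Qed.

Lemma realizable_gen : realizable (fun i v =>
  (i == k) && ((u == v) (+) (k_odd k u && (delta_mx 0 k == v)))).
Proof.
by exists (option 'I_n), gen_phrase; split; [exact: gauss_phrase_gen | exact: odd_d_gen].
Qed.

End Generator.

(** * Summation over all components and vectors *)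

Lemma odd_card_big (T : finType) (P : pred T) :
  odd #|[set x | P x]| = \big[addb/false]_x P x.
Proof.
rewrite -sum1dep_card big_mkcond (big_morph odd oddD (erefl _)) /=.
by apply: eq_bigr => x _; case: (P x).
Qed.

Theorem proposition5p5 (n : nat) (n_gt0 : (0 < n)%N)
    (B : 'I_n -> {set K n})
    (B_nonzero : forall k : 'I_n, B k \subset [set~ 0])
    (B_even : forall k : 'I_n, ~~ odd #|[set v in B k | k_odd k v]|) :
  exists (A : finType) (p : n.-tuple (seq A)),
    gauss_phrase p /\ forall k : 'I_n, Bset p k = B k.
Proof.
(* One generator is taken for each pair of a component [x.1] and a vector [x.2] of [B x.1]. *)
have [A [p [gp dp]]] := realizable_big (index_enum _)
  (fun x => x.2 \in B x.1) (fun x => realizable_gen x.1 x.2).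
exists A, p; split=> // k; apply/setP=> v; rewrite inE.
have [->|v0] /= := eqVneq v 0.
  by apply/esym/negbTE/negP=> /(subsetP (B_nonzero k)); rewrite !inE eqxx.
rewrite dp // -(pair_big_dep predT (fun k' u => u \in B k')
  (fun k' u => (k == k') && ((u == v) (+) (k_odd k' u && (delta_mx 0 k' == v))))) /=.
(* Generators built for other components contribute nothing to component [k]. *)
rewrite (bigD1 k) //= [X in _ (+) X]big1 => [|k' kk']; last first.
  by rewrite big1 // => u _; rewrite eq_sym (negPf kk').
(* The terms [u == v] sum to [v \in B k]; the correction terms at e_k must cancel. *)
rewrite addbF eqxx big_split /= -[RHS]addbF; congr (_ (+) _).
  rewrite big_mkcond (bigD1 v) //= eqxx big1 ?addbF => [|u /negPf->].
    by case: (v \in B k).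
  by case: ifP.
(* At [v] = e_k there is one correction for each [k]-odd vector of [B k], and their number is
   even. *)
case: (delta_mx 0 k == v); last by rewrite big1 // => u _; rewrite andbF.
rewrite (eq_bigr (k_odd k)) => [|u _]; last by rewrite andbT.
rewrite -[RHS](negbTE (B_even k)) odd_card_big big_mkcond.
by apply: eq_bigr => u _; case: (u \in B k).
Qed.
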